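(* Let $n>2$, $m\ge 1$, and let $X:\Sigma^n\to\mathbb{R}^{n+m}$ be a complete $\lambda$-soliton for the mean curvature flow (MCF) with respect to $\vec 0\in\mathbb{R}^{n+m}$, for some $\lambda\in\mathbb{R}$. If $\Sigma$ is parabolic, then $X$ is a self-shrinker for the MCF, i.e. $\lambda>0$.
   Context: A complete isometric immersion $X:\Sigma^n\to\mathbb{R}^{n+m}$ of an $n$-dimensional Riemannian manifold is a $\lambda$-soliton for the MCF with respect to $\vec 0$ ($\lambda\in\mathbb{R}$) if $\vec H=-\lambda X^\perp$, where $\vec H$ is the mean curvature vector of $X$ (the trace of the second fundamental form, so $\vec H=\Delta^\Sigma X$) and $X^\perp$ is the component of the position vector $X$ normal to $\Sigma$. It is a self-shrinker if $\lambda>0$ and a self-expander if $\lambda<0$. A complete Riemannian manifold $M$ is parabolic if every continuous subharmonic function $u:M\to\mathbb{R}$ ($\Delta u\ge 0$ when $u\in C^2$) with $\sup_M u<\infty$ is constant (compact connected manifolds have this property). *)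

(* Defs.v *)
From mathcomp Require Import all_boot all_order all_algebra.
From mathcomp Require Import all_classical all_reals all_analysis.

Set Implicit Arguments.
Unset Strict Implicit.
Unset Printing Implicit Defensive.

Import Order.TTheory GRing.Theory Num.Theory.
Import numFieldNormedType.Exports.

Local Open Scope classical_set_scope.
Local Open Scope ring_scope.

(** Calculus in R^n, represented by row vectors *)

Definition partial (R : realType) (n : nat) (W : normedModType R)
    (i : 'I_n) (f : 'rV[R]_n -> W) : 'rV[R]_n -> W :=
  'D_(delta_mx 0 i) f.

(* [f] is of class C^k on [U]; this is only used with [U] open, so that
   neither continuity nor the partial derivatives at a point of [U] depend on
   the values of [f] outside [U]. *)
Fixpoint is_Ck (R : realType) (n : nat) (W : normedModType R) (k : nat)
    (U : set 'rV[R]_n) (f : 'rV[R]_n -> W) : Prop :=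
  (forall x, U x -> {for x, continuous f}) /\
  if k is k'.+1 then
    forall i, (forall x, U x -> derivable f x (delta_mx 0 i)) /\
              is_Ck k' U (partial i f)
  else True.

(* Row [i] is the [i]-th partial derivative, so tangent vectors, which are row
   vectors, are pushed forward by right multiplication. *)
Definition jacobian_mx (R : realType) (n N : nat)
    (f : 'rV[R]_n -> 'rV[R]_N) (x : 'rV[R]_n) : 'M[R]_(n, N) :=
  \matrix_(i < n) partial i f x.

Definition quad_form (R : realType) (n : nat) (G : 'M[R]_n) (v : 'rV[R]_n) : R :=
  (v *m G *m v^T) 0 0.

(** Smooth manifolds *)

(* A homeomorphism from the open set [chart_dom] onto the open set [chart_cod];
   the values of the two functions outside these sets are irrelevant. *)
Record chart (R : realType) (n : nat) (M : topologicalType) := Chart {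
  chart_dom : set M;
  chart_cod : set 'rV[R]_n;
  chart_fun :> M -> 'rV[R]_n;
  chart_inv : 'rV[R]_n -> M;
  chart_dom_open : open chart_dom;
  chart_cod_open : open chart_cod;
  chart_funS : forall p, chart_dom p -> chart_cod (chart_fun p);
  chart_invS : forall x, chart_cod x -> chart_dom (chart_inv x);
  chart_funK : forall p, chart_dom p -> chart_inv (chart_fun p) = p;
  chart_invK : forall x, chart_cod x -> chart_fun (chart_inv x) = x;
  chart_fun_cts : forall p, chart_dom p -> {for p, continuous chart_fun};
  chart_inv_cts : forall x, chart_cod x -> {for x, continuous chart_inv}
}.

Definition overlap (R : realType) (n : nat) (M : topologicalType)
    (c c' : chart R n M) : set 'rV[R]_n :=
  chart_cod c `&` chart_inv c @^-1` chart_dom c'.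

Definition transition (R : realType) (n : nat) (M : topologicalType)
    (c c' : chart R n M) : 'rV[R]_n -> 'rV[R]_n :=
  c' \o chart_inv c.

(* The atlas need not be maximal: all the notions below are independent of the
   choice of a chart among smoothly compatible ones.  Manifolds are nonempty
   but connectedness is not required (a parabolic manifold is connected, since
   locally constant functions are subharmonic). *)
Record smooth_manifold (R : realType) (n : nat) := SmoothManifold {
  manifold_sort :> topologicalType;
  atlas : set (chart R n manifold_sort);
  manifold_nonempty : [set: manifold_sort] !=set0;
  manifold_hausdorff : hausdorff_space manifold_sort;
  manifold_second_countable : @second_countable manifold_sort;
  atlas_cover : forall p : manifold_sort,
    exists2 c, atlas c & chart_dom c p;
  atlas_smooth : forall c c', atlas c -> atlas c' ->
    forall k, is_Ck k (overlap c c') (transition c c')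
}.

Definition is_Ck_on (R : realType) (n : nat) (M : smooth_manifold R n)
    (W : normedModType R) (k : nat) (U : set M) (f : M -> W) : Prop :=
  forall c, atlas c ->
    is_Ck k (chart_cod c `&` chart_inv c @^-1` U) (f \o chart_inv c).

(** Riemannian manifolds *)

(* [metric c x] is the Gram matrix g_ij of the coordinate vector fields of the
   chart [c] at the point with coordinates [x]. *)
Record riemannian_manifold (R : realType) (n : nat) := RiemannianManifold {
  riemannian_sort :> smooth_manifold R n;
  metric : chart R n riemannian_sort -> 'rV[R]_n -> 'M[R]_n;
  metric_smooth : forall c, atlas c ->
    forall k, is_Ck k (chart_cod c) (metric c);
  metric_sym : forall c x, atlas c -> chart_cod c x ->
    (metric c x)^T = metric c x;
  metric_posdef : forall c x, atlas c -> chart_cod c x ->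
    forall v, v != 0 -> 0 < quad_form (metric c x) v;
  metric_change : forall c c' x, atlas c -> atlas c' -> overlap c c' x ->
    metric c x = jacobian_mx (transition c c') x
                 *m metric c' (transition c c' x)
                 *m (jacobian_mx (transition c c') x)^T
}.

(* [curve_length p q l]: some piecewise C^1 curve from [p] to [q] has length
   [l].  The curve is cut into C^1 arcs parametrized by [0, 1], each of which
   lies in the domain of a chart. *)
Inductive curve_length (R : realType) (n : nat) (M : riemannian_manifold R n) :
    M -> M -> \bar R -> Prop :=
| CurveNil p : curve_length p p 0%E
| CurveCons (c : chart R n M) (gamma : R -> 'rV[R]_n) q l :
    atlas c ->
    (forall t, 0 <= t <= 1 ->
      [/\ chart_cod c (gamma t), derivable gamma t 1
        & {for t, continuous (derive1 gamma)}]) ->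
    curve_length (chart_inv c (gamma 1)) q l ->
    curve_length (chart_inv c (gamma 0)) q
      (\int[lebesgue_measure]_(t in `[0%R, 1%R])
          (Num.sqrt (quad_form (metric c (gamma t)) (derive1 gamma t)))%:E + l)%E.

(* The value is +oo when [p] and [q] lie in different components. *)
Definition riemannian_dist (R : realType) (n : nat) (M : riemannian_manifold R n)
    (p q : M) : \bar R :=
  ereal_inf [set l | curve_length p q l].

Definition complete_manifold (R : realType) (n : nat)
    (M : riemannian_manifold R n) : Prop :=
  forall x : nat -> M,
    (forall e : R, 0 < e -> exists N : nat, forall i j : nat,
       (N <= i)%N -> (N <= j)%N -> (riemannian_dist (x i) (x j) < e%:E)%E) ->
    exists p : M, (fun i => riemannian_dist (x i) p) @ \oo --> 0%E.

(* Gamma^k_ij of the Levi-Civita connection *)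
Definition christoffel (R : realType) (n : nat) (M : riemannian_manifold R n)
    (c : chart R n M) (k i j : 'I_n) (x : 'rV[R]_n) : R :=
  let dg (a b d : 'I_n) : R := (partial a (metric c) x) b d in
  2^-1 * \sum_(l < n) invmx (metric c x) k l * (dg i j l + dg j i l - dg l i j).

(* The trace of the Hessian of [u], at the point with coordinates [x] *)
Definition laplacian (R : realType) (n : nat) (M : riemannian_manifold R n)
    (c : chart R n M) (u : M -> R^o) (x : 'rV[R]_n) : R :=
  let v : 'rV[R]_n -> R^o := u \o chart_inv c in
  \sum_(i < n) \sum_(j < n) invmx (metric c x) i j *
    (partial i (partial j v) x -
     \sum_(k < n) christoffel c k i j x * partial k v x).

(* A continuous function is subharmonic when Delta u >= 0 in the viscosity
   sense: every C^2 function [phi] defined near [p] and touching [u] from above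
   at [p] satisfies Delta phi (p) >= 0.  If [u] is C^2 this means Delta u >= 0
   (take phi = u; conversely, use the second derivative test at a maximum of
   u - phi).  For continuous functions it is equivalent to subharmonicity in the
   sense of distributions and to the comparison property with harmonic
   functions. *)
Definition subharmonic (R : realType) (n : nat) (M : riemannian_manifold R n)
    (u : M -> R^o) : Prop :=
  continuous u /\
  forall (p : M) (U : set M) (phi : M -> R^o),
    open U -> U p -> is_Ck_on 2 U phi ->
    (forall q, U q -> u q - phi q <= u p - phi p) ->
    forall c, atlas c -> chart_dom c p -> 0 <= laplacian c phi (c p).

Definition parabolic (R : realType) (n : nat)
    (M : riemannian_manifold R n) : Prop :=
  forall u : M -> R^o, subharmonic u ->
    (exists B : R, forall p, u p <= B) ->
    exists a : R, forall p, u p = a.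

(** Immersed submanifolds of R^N and solitons *)

Definition isometric_immersion (R : realType) (n N : nat)
    (M : riemannian_manifold R n) (X : M -> 'rV[R]_N) : Prop :=
  (forall k, is_Ck_on k setT X) /\
  forall c x, atlas c -> chart_cod c x ->
    let J := jacobian_mx (X \o chart_inv c) x in
    row_free J /\ J *m J^T = metric c x.

(* The orthogonal projection of [v] onto the normal space at the point with
   coordinates [x]: the tangent space is the row space of the Jacobian matrix
   [J], and its orthogonal complement is the left kernel of [J^T]. *)
Definition normal_part (R : realType) (n N : nat) (M : riemannian_manifold R n)
    (X : M -> 'rV[R]_N) (c : chart R n M) (x : 'rV[R]_n) (v : 'rV[R]_N) :
    'rV[R]_N :=
  let J := jacobian_mx (X \o chart_inv c) x in
  v *m proj_mx (kermx J^T) <<J>>%MS.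

(* II(d_i, d_j): the normal part of the derivative of d_j X in the direction
   d_i *)
Definition second_fundamental_form (R : realType) (n N : nat)
    (M : riemannian_manifold R n) (X : M -> 'rV[R]_N) (c : chart R n M)
    (x : 'rV[R]_n) (i j : 'I_n) : 'rV[R]_N :=
  normal_part X c x (partial i (partial j (X \o chart_inv c)) x).

Definition mean_curvature (R : realType) (n N : nat)
    (M : riemannian_manifold R n) (X : M -> 'rV[R]_N) (c : chart R n M)
    (x : 'rV[R]_n) : 'rV[R]_N :=
  \sum_(i < n) \sum_(j < n)
    invmx (metric c x) i j *: second_fundamental_form X c x i j.

Definition mcf_soliton (R : realType) (n N : nat) (M : riemannian_manifold R n)
    (lambda : R) (X : M -> 'rV[R]_N) : Prop :=
  [/\ complete_manifold M, isometric_immersion X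
    & forall c x, atlas c -> chart_cod c x ->
        mean_curvature X c x =
        - (lambda *: normal_part X c x (X (chart_inv c x)))].

Definition self_shrinker (R : realType) (n N : nat)
    (M : riemannian_manifold R n) (lambda : R) (X : M -> 'rV[R]_N) : Prop :=
  mcf_soliton lambda X /\ 0 < lambda.

(* Main.v *)
Require Import Defs.
From HB Require Import structures.
From mathcomp Require Import all_boot all_order all_algebra.
From mathcomp Require Import all_classical all_reals all_analysis.
From mathcomp Require Import ring lra.

(** Suppose [lambda <= 0].  Since [Delta X = H = - lambda X^perp], the function
    [u = - (1 + |X|^2)^(-1/2)] satisfies, with [q = - u],
      [Delta u = q^3 (n - lambda |X^perp|^2) - 3 q^5 |X^T|^2
               >= q^5 (n (1 + |X|^2) - 3 |X|^2)],
    which is positive as [n >= 3].  If a test function [phi] touches [u] from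
    above at a point, then the Hessian of [u - phi] is negative semidefinite
    there; writing [g^-1 = B B^T] with [B = g^-1 J], where [J] is the Jacobian
    matrix of the immersion, this gives [Delta phi >= Delta u > 0].  So [u] is
    bounded and subharmonic; by parabolicity it is constant, which contradicts
    [Delta u > 0]. *)

Set Implicit Arguments.
Unset Strict Implicit.
Unset Printing Implicit Defensive.

Import Order.TTheory GRing.Theory Num.Theory.
Import numFieldNormedType.Exports.

Local Open Scope classical_set_scope.
Local Open Scope ring_scope.

(** * Mean value theorem and differentiability *)

Lemma is_derive_line (R : realType) (V W : normedModType R) (f : V -> W)
    (x v : V) (t : R) :
  derivable f (t *: v + x) v ->
  is_derive t 1 (fun s : R => f (s *: v + x)) ('D_v f (t *: v + x)).
Proof.
move=> df; have e (h : R) : (h *: (1 : R) + t) *: v + x = h *: v + (t *: v + x).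
  by rewrite scaler1 scalerDl addrA.
apply: DeriveDef.
  rewrite /derivable; move: df; rewrite /derivable /=.
  by under [X in _ -> cvg (X @ _)]eq_fun do rewrite e.
rewrite /derive /=.
by under [X in lim (X @ _) = _]eq_fun do rewrite e.
Qed.

Lemma MVT_line (R : realType) (V : normedModType R) (f : V -> R^o)
    (x v : V) (h : R) :
  0 < h -> (forall s, 0 <= s <= h -> derivable f (s *: v + x) v) ->
  exists2 s, 0 < s < h & f (h *: v + x) - f x = h * 'D_v f (s *: v + x).
Proof.
move=> h0 df.
have [||s sh] := @MVT R (fun s => f (s *: v + x))
    (fun s => 'D_v f (s *: v + x)) 0 h h0.
- move=> s; rewrite in_itv /= => /andP[s0 sh].
  by apply: is_derive_line; apply: df; rewrite !ltW.
- apply: derivable_within_continuous => s; rewrite in_itv /= => sh.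
  by case: (is_derive_line (df s sh)).
rewrite scale0r add0r subr0 => ->; exists s; last by rewrite mulrC.
by move: sh; rewrite in_itv.
Qed.

(** For negative [h] the segment is run from its other end with step [- h]. Coordinate increments in
    the differentiability criterion below have either sign. *)
Lemma MVT_line_sym (R : realType) (V : normedModType R) (f : V -> R^o)
    (x v : V) (h : R) :
  (forall s, `|s| <= `|h| -> derivable f (s *: v + x) v) ->
  exists2 s, `|s| <= `|h| & f (h *: v + x) - f x = h * 'D_v f (s *: v + x).
Proof.
move=> df; have [h0|h0|->] := ltgtP h 0.
- have [||s /andP[s0 sh] ] := @MVT_line R V f (h *: v + x) v (- h).
  + by rewrite oppr_gt0.
  + move=> s /andP[s0 sh]; rewrite addrA -scalerDl; apply: df.
    rewrite (ltr0_norm h0) ler_norml; apply/andP; split; lra.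
  + rewrite !addrA -!scalerDl addNr scale0r add0r => E.
    exists (s + h); last by lra.
    rewrite (ltr0_norm h0) ler_norml; apply/andP; split; lra.
- have [|s /andP[s0 sh] ->] := @MVT_line R V f x v h h0.
  + by move=> s /andP[s0 sh]; apply: df; rewrite !ger0_norm// ltW.
  + by exists s => //; rewrite !gtr0_norm// ltW.
- by exists 0 => //; rewrite scale0r add0r subrr mul0r.
Qed.

Lemma coord_le_norm (R : realType) (n : nat) (x : 'rV[R]_n) (i : 'I_n) :
  `|x 0 i| <= `|x|.
Proof.
rewrite [leRHS]/Num.Def.normr/= mx_normrE.
exact: (le_bigmax _ (fun ij : 'I_1 * 'I_n => `|x ij.1 ij.2|) (0, i)).
Qed.

Lemma norm_le_coord (R : realType) (n : nat) (x y : 'rV[R]_n) :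
  (forall i, `|x 0 i| <= `|y 0 i|) -> `|x| <= `|y|.
Proof.
move=> xy; rewrite [leLHS]/Num.Def.normr/= mx_normrE.
apply: bigmax_le => // -[i j] _ /=; rewrite (ord1 i).
exact: le_trans (xy j) (coord_le_norm _ _).
Qed.

(** [x] is joined to [h + x] by a staircase that changes one coordinate at a time. On each step the
    mean value theorem replaces the increment by a partial derivative at a nearby point, which
    continuity compares with the one at [x]. *)
Lemma differentiable_partial (R : realType) (n : nat) (f : 'rV[R]_n -> R^o)
    (x : 'rV[R]_n) :
  (\forall y \near x, forall i, derivable f y (delta_mx 0 i)) ->
  (forall i, {for x, continuous (partial i f)}) ->
  differentiable f x.
Proof.
move=> df cf.
pose L0 (h : 'rV[R]_n) : R^o := \sum_i h 0 i * partial i f x.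
have Llin : linear L0.
  move=> a u v; rewrite /L0 scaler_sumr -big_split /=; apply: eq_bigr => i _.
  by rewrite !mxE mulrDl scalerAl.
pose LM := GRing.isLinear.Build _ _ _ _ _ Llin.
pose L : {linear 'rV[R]_n -> R^o} := HB.pack L0 LM.
have cL : continuous L.
  move=> h; apply: differentiable_continuous.
  rewrite /L /= (_ : L0 =
      \sum_i (fun h : 'rV[R]_n => h 0 i * partial i f x : R^o)).
    apply: differentiable_sum => i.
    by apply: differentiableM => //; exact: differentiable_coord.
  by apply/funext => k; rewrite fct_sumE.
suff fL : f \o shift x = cst (f x) + L +o_ (0 : 'rV[R]_n) id.
  have dL := diff_unique cL fL.
  by apply/diff_locallyP; rewrite dL; split.
apply/eqaddoP => e e0.
(* Each of the [n] steps will cost at most [e' * |h|]; [n.+1] keeps the divisor nonzero when [n] is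
   0. *)
pose e' := e / n.+1%:R.
have e'0 : 0 < e' by rewrite divr_gt0// ltr0n.
have {df cf} : \forall y \near x, forall i, derivable f y (delta_mx 0 i) /\
    `|partial i f y - partial i f x| <= e'.
  near=> y => i; split; first by move: i; near: y.
  move: i; near: y; apply: filter_forall => i.
  have /cvgr_dist_le/(_ _ e'0) := cf i.
  by apply: filterS => y; rewrite distrC.
move=> /nbhs_normP[d /= d0 H].
have {}H y : `|y| < d -> forall i, derivable f (y + x) (delta_mx 0 i) /\
    `|partial i f (y + x) - partial i f x| <= e'.
  by move=> yd; apply: H; rewrite /= opprD addrCA subrr addr0 normrN.
have d_near : \forall h \near (0 : 'rV[R]_n), `|h| < d.
  by apply/nbhs_normP; exists d => // y /=; rewrite sub0r normrN.
near=> h; have hd : `|h| < d by near: h.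
(* Corners of the staircase: [p 0] is 0 and [p n] is [h]. *)
pose p k : 'rV[R]_n := \row_i (if (i < k)%N then h 0 i else 0).
have main k : (k <= n)%N ->
  `|f (p k + x) - f x - \sum_(i < n | (i < k)%N) h 0 i * partial i f x|
     <= k%:R * (e' * `|h|).
  elim: k => [_|k IH kn].
    rewrite big_pred0// mul0r subr0 (_ : p 0 = 0) ?add0r ?subrr ?normr0//.
    by apply/rowP => i; rewrite !mxE.
  pose ik := Ordinal kn.
  have pS : p k.+1 = h 0 ik *: delta_mx 0 ik + p k.
    apply/rowP => i; rewrite !mxE eqxx /= ltnS leq_eqVlt.
    have [->|ni] := eqVneq i ik; first by rewrite eqxx /= ltnn mulr1 addr0.
    suff -> : (i == k :> nat) = false by rewrite mulr0 add0r.
    exact: negbTE ni.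
  (* The maximum norm of a partial staircase never exceeds that of [h], so every step stays in the
     ball where the partial derivatives are controlled. *)
  have small s : `|s| <= `|h 0 ik| -> `|s *: delta_mx 0 ik + p k| < d.
    move=> sh; apply: le_lt_trans hd; apply: norm_le_coord => i.
    rewrite !mxE eqxx /=; have [->|ni] := eqVneq i ik.
      by rewrite ltnn mulr1 addr0.
    by rewrite mulr0 add0r; case: ifP; rewrite ?normr0.
  have [|s sh E] := @MVT_line_sym R _ f (p k + x) (delta_mx 0 ik) (h 0 ik).
    by move=> s sh; rewrite addrA; apply: (H _ _ _).1; exact: small.
  rewrite (bigD1 ik) //= (eq_bigl (fun i : 'I_n => (i < k)%N)); last first.
    by move=> i; rewrite ltnS ltn_neqAle andbC.
  rewrite pS -[_ + p k + x]addrA -(subrK (f (p k + x)) (f (h 0 ik *: _ + _))) E.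
  set S := \sum_(_ < _ | _) _ in IH *.
  rewrite (_ : _ - f x - _ = h 0 ik * ('D_(delta_mx 0 ik) f
     (s *: delta_mx 0 ik + (p k + x)) - partial ik f x)
     + (f (p k + x) - f x - S)); last by ring.
  rewrite -natr1 mulrDl mul1r addrC.
  apply: le_trans (ler_normD _ _) _; apply: lerD; first exact/IH/ltnW.
  rewrite normrM mulrC; apply: ler_pM => //; last exact: coord_le_norm.
  by rewrite addrA; apply: (H _ _ _).2; exact: small.
have pn : p n = h by apply/rowP => i; rewrite mxE ltn_ord.
have := main n (leqnn n); rewrite pn.
rewrite (eq_bigl xpredT) => [|i]; last by rewrite ltn_ord.
move=> M; rewrite opprD addrA; apply: le_trans M _.
rewrite mulrA ler_wpM2r// /e' mulrCA ger_pMr// ler_pdivrMr ?ltr0n// mul1r.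
by rewrite ler_nat.
Unshelve. all: by end_near. Qed.

(** * Second derivatives *)

Lemma is_derive_translate (R : realType) (V W : normedModType R) (f : V -> W)
    (a x v : V) :
  derivable f (a + x) v ->
  is_derive x v (fun y => f (a + y)) ('D_v f (a + x)).
Proof.
move=> df; have e (h : R) : a + (h *: v + x) = h *: v + (a + x).
  exact: addrCA.
apply: DeriveDef.
  rewrite /derivable; move: df; rewrite /derivable /=.
  by under [X in _ -> cvg (X @ _)]eq_fun do rewrite e.
rewrite /derive /=.
by under [X in lim (X @ _) = _]eq_fun do rewrite e.
Qed.

(** The mean value theorem is used twice: along [u] for the increment [f (h *: v + y) - f y], then
    along [v] for [fu]. *)
Lemma second_difference (R : realType) (V : normedModType R)
    (f fu fuv : V -> R^o) (x u v : V) (h : R) :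
  0 < h ->
  (forall s t, 0 <= s <= h -> 0 <= t <= h ->
     is_derive (t *: v + (s *: u + x)) u f (fu (t *: v + (s *: u + x))) /\
     is_derive (t *: v + (s *: u + x)) v fu (fuv (t *: v + (s *: u + x)))) ->
  exists s t, [/\ 0 < s < h, 0 < t < h &
    f (h *: v + (h *: u + x)) - f (h *: u + x) - (f (h *: v + x) - f x) =
    h * (h * fuv (t *: v + (s *: u + x)))].
Proof.
move=> h0 df; have hh : 0 <= h <= h by rewrite lexx ltW.
have h00 : 0 <= (0 : R) <= h by rewrite lexx ltW.
have dg s : 0 <= s <= h -> is_derive (s *: u + x) u
    (fun y => f (h *: v + y) - f y)
    (fu (h *: v + (s *: u + x)) - fu (s *: u + x)).
  move=> sh; apply: is_deriveB.
    have [df1 <-] := (df _ _ sh hh).1.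
    exact: is_derive_translate.
  by have := (df _ _ sh h00).1; rewrite scale0r add0r.
have [|s sh ->] := MVT_line h0 (f := fun y => f (h *: v + y) - f y) (x := x)
    (v := u).
  by move=> s /dg [].
have sh' : 0 <= s <= h by move: sh => /andP[? ?]; rewrite !ltW.
have [_ ->] := dg _ sh'.
have [|t th ->] := MVT_line h0 (f := fu) (x := s *: u + x) (v := v).
  by move=> t th; have [] := (df _ _ sh' th).2.
have th' : 0 <= t <= h by move: th => /andP[? ?]; rewrite !ltW.
by exists s, t; split => //; have [_ ->] := (df _ _ sh' th').2.
Qed.

(** Schwarz's theorem: the second difference of [f] is unchanged when [u] and [v] are exchanged, so
    a value of [fuv] equals a value of [fvu], each taken close to [x]; continuity of both functions
    concludes. *)
Lemma mixed_derivatives_eq (R : realType) (V : normedModType R)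
    (f fu fv fuv fvu : V -> R^o) (x u v : V) :
  (\forall y \near x, is_derive y u f (fu y)) ->
  (\forall y \near x, is_derive y v f (fv y)) ->
  (\forall y \near x, is_derive y v fu (fuv y)) ->
  (\forall y \near x, is_derive y u fv (fvu y)) ->
  {for x, continuous fuv} -> {for x, continuous fvu} -> fuv x = fvu x.
Proof.
move=> dfu dfv dfuv dfvu cuv cvu; apply/eqP/negPn/negP => ne.
(* Half the gap: two errors below [e] cannot add up to it. *)
pose e := `|fuv x - fvu x| / 2.
have e0 : 0 < e by rewrite divr_gt0// normr_gt0 subr_eq0.
have : \forall y \near x,
    [/\ is_derive y u f (fu y) /\ is_derive y v f (fv y),
      is_derive y v fu (fuv y) /\ is_derive y u fv (fvu y),
      `|fuv x - fuv y| < e & `|fvu x - fvu y| < e].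
  near=> y; split.
  - by split; near: y.
  - by split; near: y.
  - by near: y; exact: cvgr_dist_lt.
  - by near: y; exact: cvgr_dist_lt.
move=> /nbhs_normP[d /= d0 H].
(* Chosen so that [s *: u + t *: v] has norm at most [d / 2] when [s] and [t] lie between 0 and [h];
   the added 1 keeps the divisor positive. *)
pose h := d / (2 * (`|u| + `|v| + 1)).
have uv0 : 0 < `|u| + `|v| + 1.
  by rewrite ltr_wpDl// addr_ge0.
have h0 : 0 < h by rewrite divr_gt0// mulr_gt0.
have {}H s t : 0 <= s <= h -> 0 <= t <= h ->
    let y := t *: v + (s *: u + x) in
    [/\ is_derive y u f (fu y) /\ is_derive y v f (fv y),
      is_derive y v fu (fuv y) /\ is_derive y u fv (fvu y),
      `|fuv x - fuv y| < e & `|fvu x - fvu y| < e].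
  move=> /andP[s0 sh] /andP[t0 th]; apply: H => /=.
  rewrite distrC !addrA addrK; apply: le_lt_trans (ler_normD _ _) _.
  rewrite !normrZ !ger0_norm//.
  have hd : h * (`|u| + `|v| + 1) = d / 2.
    by rewrite /h; field; rewrite gt_eqF.
  have := ler_wpM2r (normr_ge0 v) th; have := ler_wpM2r (normr_ge0 u) sh.
  by lra.
have [|s [t [sh th E1]]] := @second_difference R V f fu fuv x u v h h0.
  by move=> s t sh th; have [[? _] [? _] _ _] := H _ _ sh th.
have [|t' [s' [th' sh' E2]]] := @second_difference R V f fv fvu x v u h h0.
  move=> a b sh' th'; have [[_ ?] [_ ?] _ _] := H _ _ th' sh'.
  by rewrite addrCA.
have w r : 0 < r < h -> 0 <= r <= h by move=> /andP[? ?]; rewrite !ltW.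
have [_ _ EA _] := H _ _ (w _ sh) (w _ th).
have [_ _ _ EB] := H _ _ (w _ sh') (w _ th').
move: E2; rewrite [h *: u + (h *: v + x)]addrCA [s' *: u + _]addrCA => E2.
have E : h * (h * fuv (t *: v + (s *: u + x))) =
    h * (h * fvu (t' *: v + (s' *: u + x))).
  by rewrite -E1 -E2; ring.
have {}E := mulfI (lt0r_neq0 h0) (mulfI (lt0r_neq0 h0) E).
have : `|fuv x - fvu x| < e + e.
  rewrite -(subrK (fuv (t *: v + (s *: u + x))) (fuv x)) -addrA.
  apply: le_lt_trans (ler_normD _ _) _; apply: ltrD => //.
  by rewrite E distrC.
by rewrite /e -splitr ltxx.
Unshelve. all: by end_near. Qed.

Lemma derive_at_max (R : realType) (V : normedModType R) (f : V -> R^o)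
    (x v : V) :
  (\forall y \near x, derivable f y v) -> (\forall y \near x, f y <= f x) ->
  'D_v f x = 0.
Proof.
move=> df fmax.
have : \forall y \near x, derivable f y v /\ f y <= f x.
  by near=> y; split; near: y.
move=> /nbhs_normP[d /= d0 H].
pose h := d / (`|v| + 1).
have v0 : 0 < `|v| + 1 by rewrite ltr_wpDl.
have h0 : 0 < h by rewrite divr_gt0.
have {}H s : -h < s < h -> derivable f (s *: v + x) v /\ f (s *: v + x) <= f x.
  rewrite -ltr_norml => sh; apply: H => /=.
  rewrite opprD addrCA subrr addr0 normrN normrZ.
  have : `|s| * (`|v| + 1) < d by rewrite -ltr_pdivlMr.
  have := normr_ge0 s; lra.
have hh : -h < 0 < h by rewrite oppr_lt0 h0.
have := @is_derive_line R V R^o f x v 0; rewrite scale0r add0r => /(_ _)[].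
  by have [] := H _ hh; rewrite scale0r add0r.
move=> _ <-; apply: derive_val.
apply: (@derive1_at_max R (fun s => f (s *: v + x)) (- h) h 0).
- by lra.
- move=> t; rewrite in_itv /= => /H[dft _].
  by case: (is_derive_line dft).
- by rewrite in_itv.
- by move=> t; rewrite in_itv /= scale0r add0r => /H[].
Unshelve. all: by end_near. Qed.

(** If [l > 0], then [fv], which vanishes at the maximum [x], is positive at [s *: v + x] for small
    [s > 0]; the mean value theorem then makes [f] exceed [f x] at a point of this ray close to
    [x]. *)
Lemma second_derivative_test (R : realType) (V : normedModType R)
    (f fv : V -> R^o) (x v : V) (l : R) :
  (\forall y \near x, is_derive y v f (fv y)) -> is_derive x v fv l ->
  (\forall y \near x, f y <= f x) -> l <= 0.
Proof.
move=> df dfv fmax; rewrite leNgt; apply/negP => l0.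
have fv0 : fv x = 0.
  have [_ <-] := nbhs_singleton df; apply: derive_at_max => //.
  by apply: filterS df => y [].
have fvpos : \forall t \near (0 : R)^', 0 < t^-1 * fv (t *: v + x).
  have [] := dfv; rewrite /derivable /derive fv0 /= => cv lE.
  have {}cv : (h^-1 *: (fv (h *: v + x) - 0) : R^o) @[h --> 0^'] --> (l : R^o).
    by rewrite -lE; exact: cv.
  have cg : \forall t \near (0 : R)^',
      0 < (t^-1 *: (fv (t *: v + x) - 0) : R^o).
    by move: l0; apply: cvgr_gt.
  by apply: filterS cg => t; rewrite subr0.
have dfmax : \forall t \near (0 : R),
    is_derive (t *: v + x) v f (fv (t *: v + x))
    /\ f (t *: v + x) <= f x.
  have tx : (t *: v + x) @[t --> (0 : R)] --> x.
    suff : {for (0 : R), continuous (fun t : R => t *: v + x)}.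
      by rewrite /prop_for /continuous_at /= scale0r add0r.
    exact: differentiable_continuous.
  exact: tx (filterI df fmax).
move: fvpos => /nbhs_normP[d /= d0 Hd].
move: dfmax => /nbhs_normP[d' /= d'0 Hd'].
pose h := Num.min d d' / 2.
have m0 : 0 < Num.min d d' by rewrite lt_min d0.
have h0 : 0 < h by rewrite divr_gt0.
have hm : h < Num.min d d' by rewrite /h; lra.
have [hd hd'] : h < d /\ h < d' by move: hm; rewrite lt_min => /andP[].
have {}Hd s : 0 < s <= h -> 0 < fv (s *: v + x).
  move=> /andP[s0 sh]; have := Hd s.
  rewrite /= sub0r normrN gtr0_norm// => /(_ (le_lt_trans sh hd)).
  by rewrite gt_eqF// => /(_ isT); rewrite pmulr_rgt0// invr_gt0.
have {}Hd' s : 0 <= s <= h ->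
    is_derive (s *: v + x) v f (fv (s *: v + x)) /\ f (s *: v + x) <= f x.
  move=> /andP[s0 sh]; apply: Hd' => /=; rewrite sub0r normrN ger0_norm//.
  exact: le_lt_trans sh hd'.
have [|s /andP[s0 sh] E] := @MVT_line R V f x v h h0.
  by move=> s /Hd'[[]].
have [[_ fvE] _] : is_derive (s *: v + x) v f (fv (s *: v + x)) /\
    f (s *: v + x) <= f x by apply: Hd'; rewrite !ltW.
have [_] : is_derive (h *: v + x) v f (fv (h *: v + x)) /\
    f (h *: v + x) <= f x by apply: Hd'; rewrite lexx ltW.
rewrite leNgt -subr_gt0 E fvE mulr_gt0//.
by apply: Hd; rewrite s0 ltW.
Qed.

(** * Locality and componentwise use of C^k regularity *)

Lemma near_eq_continuous (T U : topologicalType) (f g : T -> U) (x : T) :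
  {near x, f =1 g} -> {for x, continuous f} -> {for x, continuous g}.
Proof.
move=> fg; rewrite /prop_for /continuous_at (nbhs_singleton fg) => cf.
by apply: cvg_trans cf; exact: near_eq_cvg.
Qed.

(** The first-order expansion of [f] at [x] is also one of [g], and a continuous linear map giving
    such an expansion is the differential. *)
Lemma near_eq_differentiable (R : numFieldType) (V W : normedModType R)
    (f g : V -> W) (x : V) :
  {near x, f =1 g} -> differentiable f x -> differentiable g x.
Proof.
move=> fg /diff_locallyP[cdf fo].
have go : g \o shift x = cst (g x) + 'd f x +o_ (0 : V) id.
  apply/eqaddoP => e e0; move: fo => /eqaddoP/(_ e e0).
  have fg0 : \forall h \near (0 : V), f (h + x) = g (h + x).
    by move: fg; rewrite (near_shift 0) subr0; apply: filterS => h /=.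
  apply: filterS2 fg0 => h /= E.
  by rewrite /= (nbhs_singleton fg) !fctE /= E.
by apply/diff_locallyP; rewrite (diff_unique cdf go).
Qed.

(** As [U] is open, equality on [U] is equality near each of its points, hence passes to the partial
    derivatives, and the induction on [k] goes through. *)
Lemma is_Ck_eq_on (R : realType) (n : nat) (W : normedModType R) (k : nat)
    (U : set 'rV[R]_n) (f g : 'rV[R]_n -> W) :
  open U -> {in U, f =1 g} -> is_Ck k U f -> is_Ck k U g.
Proof.
move=> oU; elim: k f g => [|k IH] f g fg [cf Hf];
  (have fgU x : U x -> {near x, f =1 g}
    by move=> Ux; near=> y; apply: fg; rewrite inE; near: y;
       exact: open_nbhs_nbhs); split.
- by move=> x Ux; apply: near_eq_continuous (cf x Ux); exact: fgU.
- by [].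
- by move=> x Ux; apply: near_eq_continuous (cf x Ux); exact: fgU.
- move=> i; have [df Ck] := Hf i; split.
    by move=> x Ux; apply: near_eq_derivable (df x Ux); exact: fgU.
  apply: IH Ck => x; rewrite inE => Ux; apply: near_eq_derive.
  exact: fgU.
Unshelve. all: by end_near. Qed.

Lemma is_derive_entry (R : realType) (V : normedModType R) (p q : nat)
    (f : V -> 'M[R]_(p, q)) (x v : V) (df : 'M[R]_(p, q))
    (a : 'I_p) (b : 'I_q) :
  is_derive x v f df -> is_derive x v (fun y => f y a b : R^o) (df a b).
Proof.
move=> [dfx <-]; apply: DeriveDef; first by have /derivable_mxP := dfx; apply.
by rewrite derive_mx// mxE.
Qed.

Lemma is_Ck_entry (R : realType) (n p q : nat) (k : nat) (U : set 'rV[R]_n)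
    (f : 'rV[R]_n -> 'M[R]_(p, q)) (a : 'I_p) (b : 'I_q) :
  open U -> is_Ck k U f -> is_Ck k U (fun y => f y a b : R^o).
Proof.
move=> oU; elim: k f => [|k IH] f [cf Hf]; split => //.
- move=> x Ux; have := @coord_continuous R p q a b (f x).
  exact: continuous_comp (cf x Ux).
- move=> x Ux; have := @coord_continuous R p q a b (f x).
  exact: continuous_comp (cf x Ux).
- move=> i; have [df Ck] := Hf i.
  have dfe x : U x -> is_derive x (delta_mx 0 i) (fun y => f y a b : R^o)
      (partial i f x a b).
    by move=> Ux; apply: is_derive_entry; apply: derivableP; exact: df.
  split; first by move=> x /dfe[].
  apply: is_Ck_eq_on (IH _ Ck) => // x; rewrite inE => /dfe dx.
  by apply/esym; apply: derive_val.
Qed.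

Lemma is_Ck_differentiable (R : realType) (n k : nat) (U : set 'rV[R]_n)
    (f : 'rV[R]_n -> R^o) (x : 'rV[R]_n) :
  open U -> U x -> is_Ck k.+1 U f -> differentiable f x.
Proof.
move=> oU Ux [_ Hf]; apply: differentiable_partial.
  by near=> y => i; apply: (Hf i).1; near: y; exact: open_nbhs_nbhs.
by move=> i; have [_ Ck] := Hf i; case: k Ck {Hf} => [|k] [+ _]; apply.
Unshelve. all: by end_near. Qed.

(** A pointwise weakening of C^2, sufficient for the second derivative test and easily checked for
    the difference of the radial function and a test function. *)
Definition twice_differentiable (R : realType) (n : nat) (f : 'rV[R]_n -> R^o)
    (x : 'rV[R]_n) : Prop :=
  (\forall y \near x, differentiable f y) /\
  forall i, differentiable (partial i f) x.

Lemma is_Ck_twice_differentiable (R : realType) (n : nat) (U : set 'rV[R]_n)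
    (f : 'rV[R]_n -> R^o) (x : 'rV[R]_n) :
  open U -> U x -> is_Ck 2 U f -> twice_differentiable f x.
Proof.
move=> oU Ux f2; split.
  near=> y; apply: is_Ck_differentiable f2 => //.
  by near: y; exact: open_nbhs_nbhs.
move=> i; have [_ /(_ i)[_ Ck]] := f2.
exact: (@is_Ck_differentiable R n 0 U _ x oU Ux Ck).
Unshelve. all: by end_near. Qed.

Lemma partialC (R : realType) (n : nat) (U : set 'rV[R]_n)
    (f : 'rV[R]_n -> R^o) (x : 'rV[R]_n) (i j : 'I_n) :
  open U -> U x -> is_Ck 2 U f ->
  partial i (partial j f) x = partial j (partial i f) x.
Proof.
move=> oU Ux [_ f2]; have [df [_ d2f]] := f2 i; have [dfj [_ d2fj]] := f2 j.
have nU (P : set 'rV[R]_n) : (forall y, U y -> P y) -> \forall y \near x, P y.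
  by move=> UP; apply: filterS UP _; exact: open_nbhs_nbhs.
apply: (@mixed_derivatives_eq R _ f (partial j f) (partial i f) _ _ x
  (delta_mx 0 j) (delta_mx 0 i)).
- by apply: nU => y Uy; apply: derivableP; exact: dfj.
- by apply: nU => y Uy; apply: derivableP; exact: df.
- by apply: nU => y Uy; apply: derivableP; exact: (d2fj i).1.
- by apply: nU => y Uy; apply: derivableP; exact: (d2f j).1.
- exact: (d2fj i).2.1.
- exact: (d2f j).2.1.
Qed.

(** * The maximum principle in coordinates *)

Lemma is_derive_differentiable_sum (R : realType) (n : nat)
    (f : 'rV[R]_n -> R^o) (x v : 'rV[R]_n) :
  differentiable f x -> is_derive x v f (\sum_i v 0 i * partial i f x).
Proof.
move=> df; apply: DeriveDef; first exact: diff_derivable.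
rewrite deriveE// {1}(row_sum_delta v) linear_sum; apply: eq_bigr => i _.
by rewrite linearZ /= /partial deriveE.
Qed.

(** The Hessian quadratic form at [b] is the second derivative of [f] in the direction [b]. *)
Lemma hessian_at_max (R : realType) (n : nat) (f : 'rV[R]_n -> R^o)
    (x b : 'rV[R]_n) :
  twice_differentiable f x -> (\forall y \near x, f y <= f x) ->
  \sum_i \sum_j b 0 i * b 0 j * partial i (partial j f) x <= 0.
Proof.
move=> [df d2f] fmax.
apply: (@second_derivative_test R _ f (fun y => \sum_j b 0 j * partial j f y)
  x b) fmax.
  by apply: filterS df => y; exact: is_derive_differentiable_sum.
rewrite exchange_big /=.
rewrite (_ : (fun _ => _) = \sum_j (b 0 j \*: partial j f)); last first.
  by apply/funext => y; rewrite fct_sumE.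
apply: is_derive_eq.
  apply: is_derive_sum => j; apply: is_deriveZ.
  exact: is_derive_differentiable_sum (d2f j).
apply: eq_bigr => j _; rewrite scaler_sumr; apply: eq_bigr => i _.
by rewrite scalerAl [_ *: _]mulrC.
Qed.

(** At a maximum the gradient vanishes, which removes the [Gamma] terms. With [G = B *m B^T] the
    rest is a sum, over the columns of [B], of Hessian quadratic forms, each nonpositive. *)
Lemma elliptic_at_max (R : realType) (n p : nat) (G : 'M[R]_n)
    (B : 'M[R]_(n, p)) (Gamma : 'I_n -> 'I_n -> 'I_n -> R)
    (f : 'rV[R]_n -> R^o) (x : 'rV[R]_n) :
  G = B *m B^T ->
  twice_differentiable f x -> (\forall y \near x, f y <= f x) ->
  \sum_i \sum_j G i j * (partial i (partial j f) x -
    \sum_k Gamma k i j * partial k f x) <= 0.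
Proof.
move=> GB f2 fmax.
have df0 k : partial k f x = 0.
  apply: derive_at_max => //; apply: filterS (f2.1) => y; exact: diff_derivable.
under eq_bigr => i _ do under eq_bigr => j _ do
  (rewrite big1 ?subr0; [|by move=> k _; rewrite df0 mulr0]).
have -> : \sum_i \sum_j G i j * partial i (partial j f) x =
    \sum_a \sum_i \sum_j B i a * B j a * partial i (partial j f) x.
  rewrite [RHS]exchange_big /=; apply: eq_bigr => i _.
  rewrite [RHS]exchange_big /=; apply: eq_bigr => j _.
  rewrite GB mxE mulr_suml; apply: eq_bigr => a _; by rewrite mxE.
apply: sumr_le0 => a _.
have := hessian_at_max (\row_i B i a) f2 fmax.
by under eq_bigr => i _ do under eq_bigr => j _ do rewrite !mxE.
Qed.

(** The formula for the first partial derivatives holds on a whole neighbourhood of [x], so it can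
    be differentiated once more at [x]. *)
Lemma twice_differentiableB (R : realType) (n : nat) (f g : 'rV[R]_n -> R^o)
    (x : 'rV[R]_n) :
  twice_differentiable f x -> twice_differentiable g x ->
  [/\ twice_differentiable (f - g) x,
    forall i, partial i (f - g) x = partial i f x - partial i g x &
    forall i j, partial i (partial j (f - g)) x =
      partial i (partial j f) x - partial i (partial j g) x].
Proof.
move=> [df d2f] [dg d2g].
have near_d : \forall y \near x,
    differentiable f y /\ differentiable g y by exact: filterI.
have pE i y : differentiable f y /\ differentiable g y ->
    partial i (f - g) y = partial i f y - partial i g y.
  by move=> [dfy dgy]; rewrite /partial deriveB//; exact: diff_derivable.
have npE i : \forall y \near x,
    (partial i f - partial i g) y = partial i (f - g) y.
  by apply: filterS near_d => y /(pE i) ->.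
split.
- split; first by apply: filterS near_d => y []; exact: differentiableB.
  move=> i.
  apply: near_eq_differentiable (npE i) _; exact: differentiableB.
- by move=> i; apply: pE; exact: nbhs_singleton near_d.
- move=> i j; rewrite /partial -(near_eq_derive _ (npE j)) deriveB//.
    exact: diff_derivable.
  exact: diff_derivable.
Qed.

(** * Induced metrics *)

(** If [v *m J *m J^T = 0], then the squared length of [v *m J] is 0, and [v = 0] since [J] is row
    free. *)
Lemma gram_unitmx (R : realFieldType) (n N : nat) (J : 'M[R]_(n, N)) :
  row_free J -> J *m J^T \in unitmx.
Proof.
move=> Jfree; rewrite -row_free_unit -kermx_eq0; apply/rowV0P => v.
move=> /sub_kermxP vg; apply: (row_free_inj Jfree); rewrite mul0mx.
have : ((v *m J) *m (v *m J)^T) 0 0 = 0.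
  by rewrite trmx_mul mulmxA -(mulmxA v) vg mul0mx mxE.
rewrite mxE => /eqP; rewrite psumr_eq0 => [/allP vJ0|e _]; last first.
  by rewrite !mxE -expr2 sqr_ge0.
apply/rowP => e; have := vJ0 e (mem_index_enum e).
by rewrite [_^T _ _]mxE mulf_eq0 orbb => /eqP ->; rewrite mxE.
Qed.

(** * Dot products and orthogonal projection *)

Definition dotr (R : realFieldType) (N : nat) (u v : 'rV[R]_N) : R :=
  (u *m v^T) 0 0.

Lemma dotrE (R : realFieldType) (N : nat) (u v : 'rV[R]_N) :
  dotr u v = \sum_e u 0 e * v 0 e.
Proof. by rewrite /dotr mxE; apply: eq_bigr => e _; rewrite mxE. Qed.

Lemma dotrC (R : realFieldType) (N : nat) (u v : 'rV[R]_N) :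
  dotr u v = dotr v u.
Proof. by rewrite !dotrE; apply: eq_bigr => e _; rewrite mulrC. Qed.

Lemma dotr_ge0 (R : realFieldType) (N : nat) (u : 'rV[R]_N) : 0 <= dotr u u.
Proof. by rewrite dotrE; apply: sumr_ge0 => e _; rewrite -expr2 sqr_ge0. Qed.

(** The subtracted term lies in the row space of [J], what remains is killed by [J^T], and the two
    spaces meet only in 0 because [J *m J^T] is invertible; so this is the decomposition that
    [proj_mx] computes. *)
Lemma proj_kermxE (R : realFieldType) (n N : nat) (J : 'M[R]_(n, N))
    (v : 'rV[R]_N) :
  row_free J ->
  v *m proj_mx (kermx J^T) <<J>>%MS = v - v *m J^T *m invmx (J *m J^T) *m J.
Proof.
move=> Jfree; have gU := gram_unitmx Jfree.
have cap0 : (kermx J^T :&: <<J>>)%MS = 0.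
  apply/eqP/rowV0P => w; rewrite sub_capmx genmxE => /andP[/sub_kermxP wJ].
  move=> /submxP[a wE]; move: wJ; rewrite wE -mulmxA => aJ.
  by rewrite -(mulmxK gU a) aJ !mul0mx.
rewrite -{1}(subrK (v *m J^T *m invmx (J *m J^T) *m J) v) mulmxDl.
rewrite proj_mx_id// ?proj_mx_0 ?addr0//.
  by rewrite genmxE submxMl.
apply/sub_kermxP; rewrite mulmxBl -!mulmxA mulVmx// mulmx1 subrr//.
Qed.

Lemma is_derive_dotr (R : realType) (V : normedModType R) (N : nat)
    (f h : V -> 'rV[R]_N) (x v : V) (df dh : 'rV[R]_N) :
  is_derive x v f df -> is_derive x v h dh ->
  is_derive x v (fun y => dotr (f y) (h y) : R^o)
    (dotr df (h x) + dotr (f x) dh).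
Proof.
move=> dfx dhx.
rewrite (_ : (fun _ => _) = \sum_e ((fun y => f y 0 e) * (fun y => h y 0 e)));
  last by apply/funext => y; rewrite dotrE fct_sumE.
apply: is_derive_eq.
  apply: is_derive_sum => e; apply: is_deriveM; exact: is_derive_entry.
rewrite !dotrE -big_split; apply: eq_bigr => e _ /=.
rewrite /GRing.scale /=; ring.
Qed.

Lemma differentiable_dotr (R : realType) (V : normedModType R) (N : nat)
    (f h : V -> 'rV[R]_N) (x : V) :
  (forall e, differentiable (fun y => f y 0 e : R^o) x) ->
  (forall e, differentiable (fun y => h y 0 e : R^o) x) ->
  differentiable (fun y => dotr (f y) (h y) : R^o) x.
Proof.
move=> df dh.
rewrite (_ : (fun _ => _) = \sum_e ((fun y => f y 0 e) * (fun y => h y 0 e)));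
  last by apply/funext => y; rewrite dotrE fct_sumE.
by apply: differentiable_sum => e; apply: differentiableM.
Qed.

(** * Derivatives of the inverse square root *)

Lemma is_derive_invsqrt (R : realType) (t : R) : 0 < t ->
  is_derive t 1 (fun t : R => (Num.sqrt t)^-1 : R^o)
    (- 2^-1 * (Num.sqrt t)^-1 ^+ 3).
Proof.
move=> t0; have s0 : Num.sqrt t != 0 by rewrite gt_eqF// sqrtr_gt0.
have [ds dsE] := is_derive1_sqrt t0.
apply: DeriveDef; first exact: (derivableV s0 ds).
by rewrite (deriveV s0 ds) dsE /GRing.scale /=; field; rewrite s0.
Qed.

Lemma differentiable_invsqrt (R : realType) (V : normedModType R)
    (s : V -> R^o) (x : V) :
  0 < s x -> differentiable s x ->
  differentiable (fun y => (Num.sqrt (s y))^-1 : R^o) x.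
Proof.
move=> s0 ds.
apply: (differentiable_comp (g := fun t : R => (Num.sqrt t)^-1 : R^o)) => //.
by apply/derivable1_diffP; have [] := is_derive_invsqrt s0.
Qed.

Lemma is_derive_invsqrt_comp (R : realType) (V : normedModType R)
    (s : V -> R^o) (x v : V) (ds : R) :
  0 < s x -> differentiable s x -> is_derive x v s ds ->
  is_derive x v (fun y => (Num.sqrt (s y))^-1 : R^o)
    (- 2^-1 * (Num.sqrt (s x))^-1 ^+ 3 * ds).
Proof.
move=> s0 dfs [_ <-]; have dPhi := is_derive_invsqrt s0.
have dPhi' : differentiable (fun t : R => (Num.sqrt t)^-1 : R^o) (s x).
  by apply/derivable1_diffP; case: dPhi.
apply: DeriveDef; first exact/diff_derivable/differentiable_invsqrt.
rewrite deriveE; last exact: differentiable_invsqrt.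
rewrite (diff_comp (g := fun t : R => (Num.sqrt t)^-1 : R^o))//=.
(* By linearity the differential of the inverse square root need only be known at 1, where it is the
   ordinary derivative. *)
have -> : 'd s x v = 'D_v s x *: (1 : R).
  by rewrite deriveE// /GRing.scale /= mulr1.
by rewrite linearZ /= -deriveE// derive_val [LHS]mulrC.
Qed.

(** * Matrix-valued second derivatives and Koszul's formula *)

Lemma partial_entry (R : realType) (n p q : nat) (U : set 'rV[R]_n)
    (f : 'rV[R]_n -> 'M[R]_(p, q)) (k : nat) (i : 'I_n) (x : 'rV[R]_n)
    (a : 'I_p) (b : 'I_q) :
  U x -> is_Ck k.+1 U f ->
  partial i (fun y => f y a b : R^o) x = partial i f x a b.
Proof.
move=> Ux [_ /(_ i)[df _]]; apply: derive_val.
by apply: is_derive_entry; apply: derivableP; exact: df.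
Qed.

Lemma partialC_mx (R : realType) (n p q : nat) (U : set 'rV[R]_n)
    (f : 'rV[R]_n -> 'M[R]_(p, q)) (x : 'rV[R]_n) (i j : 'I_n) :
  open U -> U x -> is_Ck 2 U f ->
  partial i (partial j f) x = partial j (partial i f) x.
Proof.
move=> oU Ux f2; apply/matrixP => a b.
have nU (P : set 'rV[R]_n) : (forall y, U y -> P y) -> \forall y \near x, P y.
  by move=> UP; apply: filterS UP _; exact: open_nbhs_nbhs.
have E k l : partial k (partial l f) x a b =
    partial k (partial l (fun y => f y a b : R^o)) x.
  have Hl : is_Ck 1 U (partial l f) by have [_] := f2.2 l.
  rewrite -(partial_entry k a b Ux Hl).
  apply: near_eq_derive; apply: nU => y Uy.
  by rewrite (partial_entry l a b Uy f2).
have C := partialC i j oU Ux (is_Ck_entry a b oU f2).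
exact: etrans (E i j) (etrans C (esym (E j i))).
Qed.

Lemma gramE (R : realType) (n N : nat) (f : 'rV[R]_n -> 'rV[R]_N)
    (x : 'rV[R]_n) (i j : 'I_n) :
  (jacobian_mx f x *m (jacobian_mx f x)^T) i j =
  dotr (partial i f x) (partial j f x).
Proof. by rewrite mxE dotrE; apply: eq_bigr => e _; rewrite !mxE. Qed.

(* Koszul's formula for an induced metric; the cancellation is the symmetry of
   the second derivatives of [Y]. *)
Lemma koszul_gram (R : realType) (n N : nat) (U : set 'rV[R]_n)
    (Y : 'rV[R]_n -> 'rV[R]_N) (g : 'rV[R]_n -> 'M[R]_n) (x : 'rV[R]_n)
    (i j l : 'I_n) :
  open U -> U x -> is_Ck 2 U Y -> is_Ck 1 U g ->
  (forall y, U y -> g y = jacobian_mx Y y *m (jacobian_mx Y y)^T) ->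
  partial i g x j l + partial j g x i l - partial l g x i j =
  2 * dotr (partial i (partial j Y) x) (partial l Y x).
Proof.
move=> oU Ux Y2 g1 gJ.
have dg a b d : partial a g x b d =
    dotr (partial a (partial b Y) x) (partial d Y x) +
    dotr (partial b Y x) (partial a (partial d Y) x).
  rewrite -(partial_entry a b d Ux g1).
  transitivity
    (partial a (fun y => dotr (partial b Y y) (partial d Y y) : R^o) x).
    apply: near_eq_derive; apply: filterS (open_nbhs_nbhs (conj oU Ux)) => y Uy.
    by rewrite gJ// gramE.
  have dY c :
      is_derive x (delta_mx 0 a) (partial c Y) (partial a (partial c Y) x).
    by apply: derivableP; exact: ((Y2.2 c).2.2 a).1.
  by case: (is_derive_dotr (dY b) (dY d)).
have cancel (p q r : R) (Hij Hji Hil Hli Hjl Hlj Yi Yj Yl : 'rV[R]_N) :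
    p = dotr Hij Yl + dotr Yj Hil -> q = dotr Hji Yl + dotr Yi Hjl ->
    r = dotr Hli Yj + dotr Yi Hlj -> Hji = Hij -> Hli = Hil -> Hlj = Hjl ->
    p + q - r = 2 * dotr Hij Yl.
  by move=> -> -> -> -> -> ->; rewrite (dotrC Yj Hil); ring.
exact: cancel (dg i j l) (dg j i l) (dg l i j) (partialC_mx j i oU Ux Y2)
  (partialC_mx l i oU Ux Y2) (partialC_mx l j oU Ux Y2).
Qed.

(** * The radial function on a soliton *)

Lemma dotrDr (R : realFieldType) (N : nat) (u v w : 'rV[R]_N) :
  dotr u (v + w) = dotr u v + dotr u w.
Proof. by rewrite /dotr linearD mulmxDr mxE. Qed.

Lemma dotrZr (R : realFieldType) (N : nat) (a : R) (u v : 'rV[R]_N) :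
  dotr u (a *: v) = a * dotr u v.
Proof. by rewrite /dotr linearZ /= -scalemxAr mxE. Qed.

Lemma dotr_sumr (R : realFieldType) (N : nat) (I : finType) (u : 'rV[R]_N)
    (v : I -> 'rV[R]_N) :
  dotr u (\sum_i v i) = \sum_i dotr u (v i).
Proof.
apply: (big_morph (dotr u)); first exact: dotrDr.
by rewrite /dotr trmx0 mulmx0 mxE.
Qed.

(** For [G] the inverse Gram matrix, this is the inner product of [u] with the tangential part of
    [v], expanded in the coordinate frame for comparison with the Christoffel terms. *)
Lemma dotr_mulmx_tr (R : realFieldType) (n N : nat) (J : 'M[R]_(n, N))
    (u v : 'rV[R]_N) (G : 'M[R]_n) :
  dotr u (v *m J^T *m G *m J) =
  \sum_k \sum_l G l k * dotr v (row l J) * dotr u (row k J).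
Proof.
have e (w : 'rV[R]_N) k : dotr w (row k J) = (w *m J^T) 0 k.
  by rewrite dotrE mxE; apply: eq_bigr => a _; rewrite !mxE.
rewrite dotrC dotrE.
under eq_bigr => a _ do (rewrite mxE mulr_suml).
rewrite exchange_big /=; apply: eq_bigr => k _.
transitivity ((v *m J^T *m G) 0 k * dotr u (row k J)).
  rewrite dotrE mulr_sumr; apply: eq_bigr => a _.
  by rewrite [row _ _ _ _]mxE; ring.
by rewrite [in LHS]mxE mulr_suml; apply: eq_bigr => l _; rewrite (e v l); ring.
Qed.

(** [ny] is orthogonal to the rows of [J], hence to the tangential part [y - ny]. *)
Lemma normal_projection_pythagoras (R : realFieldType) (n N : nat)
    (J : 'M[R]_(n, N)) (y : 'rV[R]_N) :
  row_free J ->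
  let ny := y - y *m J^T *m invmx (J *m J^T) *m J in dotr y ny = dotr ny ny.
Proof.
move=> Jfree; set G := invmx _ => ny; have gU := gram_unitmx Jfree.
have nyJ : ny *m J^T = 0.
  by rewrite /ny mulmxBl -!mulmxA mulVmx// mulmx1 subrr.
rewrite -{1}(subrK (y *m J^T *m G *m J) y) -/ny dotrC dotrDr.
rewrite [X in _ + X](_ : _ = 0) ?addr0//.
by rewrite /dotr !trmx_mul !mulmxA nyJ !mul0mx mxE.
Qed.

(** The pointwise inequality reduced to linear algebra: [y] stands for the position, [A i j] for the
    second derivatives of the immersion, [Gamma] for the Christoffel symbols and [q] for minus the
    radial function. The sum is then the Laplacian of the radial function, computed from three
    traces. *)
Lemma soliton_trace_gt0 (R : realFieldType) (n N : nat) (J : 'M[R]_(n, N))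
    (y : 'rV[R]_N) (A : 'I_n -> 'I_n -> 'rV[R]_N)
    (Gamma : 'I_n -> 'I_n -> 'I_n -> R) (lambda q : R) :
  let G := invmx (J *m J^T) in
  let normal v := v - v *m J^T *m G *m J in
  (2 < n)%N -> row_free J -> lambda <= 0 -> 0 < q ->
  q ^+ 2 * (1 + dotr y y) = 1 ->
  (forall k i j, Gamma k i j = \sum_l G k l * dotr (A i j) (row l J)) ->
  \sum_i \sum_j G i j *: normal (A i j) = - (lambda *: normal y) ->
  0 < \sum_i \sum_j G i j *
    (q ^+ 3 * (dotr (row i J) (row j J) + dotr y (A i j))
     - 3 * q ^+ 5 * (dotr y (row i J) * dotr y (row j J))
     - \sum_k Gamma k i j * (q ^+ 3 * dotr y (row k J))).
Proof.
move=> G normal n2 Jfree l0 q0 q1 GammaE soliton.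
have gU := gram_unitmx Jfree.
have Gsym i j : G i j = G j i.
  have : G^T = G by rewrite /G trmx_inv trmx_mul trmxK.
  by move=> /matrixP/(_ j i); rewrite mxE.
(* By orthogonality [t] is the squared length of the normal part of [y]. *)
pose t := dotr y (normal y).
have t0 : 0 <= t by rewrite /t normal_projection_pythagoras// dotr_ge0.
have dotN v : dotr y (normal v) =
    dotr y v - \sum_k \sum_l G l k * dotr v (row l J) * dotr y (row k J).
  by rewrite /normal dotrDr -scaleN1r dotrZr mulN1r dotr_mulmx_tr.
have trace_g : \sum_i \sum_j G i j * dotr (row i J) (row j J) = n%:R.
  rewrite -[RHS](mxtrace1 R n) -(mulVmx gU) -/G /mxtrace.
  apply: eq_bigr => i _; rewrite mxE; apply: eq_bigr => j _.
  congr (_ * _); rewrite dotrC dotrE mxE.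
  by apply: eq_bigr => a _; rewrite !mxE.
have trace_H : \sum_i \sum_j G i j * dotr y (normal (A i j)) = - lambda * t.
  transitivity (dotr y (- (lambda *: normal y))).
    rewrite -soliton dotr_sumr; apply: eq_bigr => i _.
    by rewrite dotr_sumr; apply: eq_bigr => j _; rewrite dotrZr.
  by rewrite -scaleNr dotrZr.
(* Contracting the tangential components of [y] with the inverse metric gives the squared length of
   its tangential part. *)
have trace_T : \sum_i \sum_j G i j * (dotr y (row i J) * dotr y (row j J)) =
    dotr y y - t.
  rewrite /t dotN opprB addrC subrK; apply: eq_bigr => i _.
  by apply: eq_bigr => j _; rewrite Gsym; ring.
rewrite (_ : \sum_i _ = q ^+ 3 * (n%:R - lambda * t)
    - 3 * q ^+ 5 * (dotr y y - t)); last first.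
  rewrite -mulNr -trace_g -trace_H -trace_T -big_split /= !mulr_sumr -sumrB.
  apply: eq_bigr => i _; rewrite -big_split /= !mulr_sumr -sumrB.
  apply: eq_bigr => j _; rewrite dotN.
  (* Up to [q ^+ 3], the Christoffel terms are [y] paired with the tangential part of [A i j];
     subtracting them leaves the normal part, that is, the second fundamental form. *)
  have -> : \sum_k Gamma k i j * (q ^+ 3 * dotr y (row k J)) =
      q ^+ 3 * \sum_k \sum_l G l k * dotr (A i j) (row l J) * dotr y (row k J).
    rewrite mulr_sumr; apply: eq_bigr => k _; rewrite GammaE mulr_suml.
    rewrite mulr_sumr.
    by apply: eq_bigr => l _; rewrite Gsym; ring.
  ring.
have yy0 := dotr_ge0 y.
have n3 : 3 <= n%:R :> R by rewrite ler_nat.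
have lt0 : 0 <= - lambda * t by rewrite mulr_ge0// oppr_ge0.
have -> : q ^+ 3 * (n%:R - lambda * t) - 3 * q ^+ 5 * (dotr y y - t) =
    q ^+ 5 * ((1 + dotr y y) * (n%:R + - lambda * t) - 3 * (dotr y y - t)).
  have -> : q ^+ 3 = q ^+ 5 * (1 + dotr y y).
    by rewrite (exprD q 3 2) -mulrA q1 mulr1.
  ring.
rewrite mulr_gt0 ?exprn_gt0//.
(* With [s = - lambda * t], the bracket expands to [n + |y|^2 (n - 3) + s + |y|^2 s + 3 t]. The two
   products with [|y|^2] are bounded below first, since [lra] is linear; the one with [n - 3] is
   where the dimension enters. *)
have := mulr_ge0 yy0 lt0.
have : 0 <= dotr y y * (n%:R - 3) by rewrite mulr_ge0// subr_ge0.
lra.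
Qed.

(** A smoothing at the origin of [- 1 / |p|], the Newtonian potential of three-dimensional space; on
    flat R^n it is subharmonic exactly when n >= 3. *)
Definition radial (R : realType) (N : nat) (p : 'rV[R]_N) : R^o :=
  - (Num.sqrt (1 + dotr p p))^-1.
Arguments radial {R N} p.

Lemma radial_arg_gt0 (R : realType) (N : nat) (p : 'rV[R]_N) :
  0 < 1 + dotr p p.
Proof. by rewrite ltr_pwDl// dotr_ge0. Qed.

Lemma radial_sqr (R : realType) (N : nat) (p : 'rV[R]_N) :
  (- radial p) ^+ 2 * (1 + dotr p p) = 1.
Proof.
have p0 := radial_arg_gt0 p.
by rewrite opprK exprVn sqr_sqrtr ?mulVf// ?ltW// gt_eqF.
Qed.

Lemma radial_lt0 (R : realType) (N : nat) (p : 'rV[R]_N) : radial p < 0.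
Proof. by rewrite oppr_lt0 invr_gt0 sqrtr_gt0 radial_arg_gt0. Qed.

(** * Derivatives of the radial function along a map *)

Lemma is_Ck_coord_differentiable (R : realType) (n N k : nat)
    (U : set 'rV[R]_n) (Y : 'rV[R]_n -> 'rV[R]_N) (y : 'rV[R]_n) (e : 'I_N) :
  open U -> U y -> is_Ck k.+1 U Y -> differentiable (fun z => Y z 0 e : R^o) y.
Proof.
by move=> oU Uy Yk; exact: is_Ck_differentiable oU Uy (is_Ck_entry 0 e oU Yk).
Qed.

Lemma radial_arg_differentiable (R : realType) (n N k : nat)
    (U : set 'rV[R]_n) (Y : 'rV[R]_n -> 'rV[R]_N) (y : 'rV[R]_n) :
  open U -> U y -> is_Ck k.+1 U Y ->
  differentiable (fun z => 1 + dotr (Y z) (Y z) : R^o) y.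
Proof.
move=> oU Uy Yk.
apply: (@differentiableD R _ R^o (cst 1) (fun z => dotr (Y z) (Y z))) => //.
by apply: differentiable_dotr => e; exact: is_Ck_coord_differentiable oU Uy Yk.
Qed.

Lemma radial_differentiable (R : realType) (n N k : nat)
    (U : set 'rV[R]_n) (Y : 'rV[R]_n -> 'rV[R]_N) (y : 'rV[R]_n) :
  open U -> U y -> is_Ck k.+1 U Y -> differentiable (radial \o Y) y.
Proof.
move=> oU Uy Yk; apply: (@differentiableN R _ R^o
  (fun z => (Num.sqrt (1 + dotr (Y z) (Y z)))^-1)).
apply: differentiable_invsqrt; first exact: radial_arg_gt0.
exact: radial_arg_differentiable oU Uy Yk.
Qed.

Lemma is_derive_radial (R : realType) (n N k : nat)
    (U : set 'rV[R]_n) (Y : 'rV[R]_n -> 'rV[R]_N) (y : 'rV[R]_n) (j : 'I_n) :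
  open U -> U y -> is_Ck k.+1 U Y ->
  is_derive y (delta_mx 0 j) (radial \o Y)
    ((- radial (Y y)) ^+ 3 * dotr (Y y) (partial j Y y)).
Proof.
move=> oU Uy Yk; have dY : is_derive y (delta_mx 0 j) Y (partial j Y y).
  by apply: derivableP; exact: (Yk.2 j).1.
have ds : is_derive y (delta_mx 0 j) (fun z => 1 + dotr (Y z) (Y z) : R^o)
    (0 + (dotr (partial j Y y) (Y y) + dotr (Y y) (partial j Y y))).
  exact: (is_deriveD (is_derive_cst _ _ _) (is_derive_dotr dY dY)).
have h := is_deriveN (is_derive_invsqrt_comp
  (s := fun z => 1 + dotr (Y z) (Y z)) (radial_arg_gt0 (Y y))
  (radial_arg_differentiable oU Uy Yk) ds).
apply: (is_derive_eq h).
rewrite /radial opprK (dotrC (partial j Y y)).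
by move: (Num.sqrt _)^-1 (dotr _ (partial _ _ _)) => a b; field.
Qed.

(** With [q = - radial], the first derivatives are [q^3 <Y, d_j Y>] throughout [U]; since
    [d_i q = - q^3 <Y, d_i Y>], differentiating [q^3] produces the term in [q^5]. *)
Lemma partial_radial (R : realType) (n N : nat)
    (U : set 'rV[R]_n) (Y : 'rV[R]_n -> 'rV[R]_N) (x : 'rV[R]_n) :
  open U -> U x -> is_Ck 2 U Y ->
  [/\ twice_differentiable (radial \o Y) x,
    forall k, partial k (radial \o Y) x =
      (- radial (Y x)) ^+ 3 * dotr (Y x) (partial k Y x) &
    forall i j, partial i (partial j (radial \o Y)) x =
      (- radial (Y x)) ^+ 3 * (dotr (partial i Y x) (partial j Y x) +
                               dotr (Y x) (partial i (partial j Y) x))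
      - 3 * (- radial (Y x)) ^+ 5 *
        (dotr (Y x) (partial i Y x) * dotr (Y x) (partial j Y x))].
Proof.
move=> oU Ux Y2.
have Y1 j : is_Ck 1 U (partial j Y) := (Y2.2 j).2.
pose p := - (radial \o Y); pose a j y : R^o := dotr (Y y) (partial j Y y).
(* The cube is written as a product of functions so that the product rules apply. *)
have pE j y : U y -> partial j (radial \o Y) y = (p * p * p * a j) y.
  move=> Uy; have [_] := is_derive_radial j oU Uy Y2.
  rewrite /partial => ->; rewrite /p /a !fctE; ring.
have npE j : \near x, (p * p * p * a j) x = partial j (radial \o Y) x.
  apply: filterS (open_nbhs_nbhs (conj oU Ux)) => y Uy; exact/esym/pE.
have dp : differentiable p x.
  exact: differentiableN (radial_differentiable oU Ux Y2).
have da j : differentiable (a j) x.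
  apply: differentiable_dotr => e.
    exact: is_Ck_coord_differentiable oU Ux Y2.
  exact: is_Ck_coord_differentiable oU Ux (Y1 j).
split.
- split.
    apply: filterS (open_nbhs_nbhs (conj oU Ux)) => y Uy.
    exact: radial_differentiable oU Uy Y2.
  move=> i; apply: near_eq_differentiable (npE i) _.
  by do 3?[apply: differentiableM].
- by move=> k; rewrite pE// /p /a !fctE; ring.
- move=> i j.
  have p' : is_derive x (delta_mx 0 i) p (- (p x ^+ 3 * a i x)).
    exact: is_deriveN (is_derive_radial i oU Ux Y2).
  have a' : is_derive x (delta_mx 0 i) (a j)
      (dotr (partial i Y x) (partial j Y x) +
       dotr (Y x) (partial i (partial j Y) x)).
    by apply: is_derive_dotr; apply: derivableP;
      [exact: (Y2.2 i).1|exact: ((Y1 j).2 i).1].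
  have D := is_deriveM (is_deriveM (is_deriveM p' p') p') a'.
  have [_ DE] := near_eq_is_derive (npE j) D.
  have alg (b c d e : R) : b * b * b * c + e * (b * b * - (b ^+ 3 * d) +
      b * (b * - (b ^+ 3 * d) + b * - (b ^+ 3 * d))) =
      b ^+ 3 * c - 3 * b ^+ 5 * (d * e) by ring.
  exact: etrans DE (alg _ _ _ _).
Qed.

(** The metric is the Gram matrix of the coordinate derivatives of [X], so Koszul's formula turns
    the Christoffel symbols into tangential components of the second derivatives. *)
Lemma christoffelE (R : realType) (n N : nat) (M : riemannian_manifold R n)
    (X : M -> 'rV[R]_N) (c : chart R n M) (x : 'rV[R]_n) (k i j : 'I_n) :
  isometric_immersion X -> atlas c -> chart_cod c x ->
  let Y := X \o chart_inv c in
  christoffel c k i j x = \sum_l invmx (metric c x) k l *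
    dotr (partial i (partial j Y) x) (row l (jacobian_mx Y x)).
Proof.
move=> [XC Xiso] ac cx Y.
have oU := @chart_cod_open _ _ _ c.
have Y2 : is_Ck 2 (chart_cod c) Y.
  have := XC 2 c ac; by rewrite preimage_setT setIT.
have g1 : is_Ck 1 (chart_cod c) (metric c) by exact: metric_smooth.
have gJ y : chart_cod c y ->
    metric c y = jacobian_mx Y y *m (jacobian_mx Y y)^T.
  by move=> cy; have [_ <-] := Xiso c y ac cy.
rewrite /christoffel mulr_sumr; apply: eq_bigr => l _.
rewrite (koszul_gram i j l oU cx Y2 g1 gJ) rowK.
by rewrite mulrCA mulKf// pnatr_eq0.
Qed.

(** Transfers [soliton_trace_gt0] to the manifold: the Gram matrix of the Jacobian is the metric,
    and [proj_kermxE] puts the soliton equation in the form of the hypothesis on normal parts. *)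
Lemma laplacian_radial_gt0 (R : realType) (n N : nat)
    (M : riemannian_manifold R n) (lambda : R) (X : M -> 'rV[R]_N)
    (c : chart R n M) (x : 'rV[R]_n) :
  (2 < n)%N -> lambda <= 0 -> mcf_soliton lambda X -> atlas c ->
  chart_cod c x -> 0 < laplacian c (radial \o X) x.
Proof.
move=> n2 l0 [_ Xiso soliton] ac cx.
have oU := @chart_cod_open _ _ _ c.
pose Y := X \o chart_inv c.
have Y2 : is_Ck 2 (chart_cod c) Y.
  by have := Xiso.1 2 c ac; rewrite preimage_setT setIT.
have [Jfree gJ] := Xiso.2 c x ac cx.
have [_ p1 p2] := partial_radial oU cx Y2.
have q0 : 0 < - radial (Y x) by rewrite oppr_gt0 radial_lt0.
have := @soliton_trace_gt0 R n N (jacobian_mx Y x) (Y x)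
  (fun i j => partial i (partial j Y) x)
  (fun k i j => christoffel c k i j x) lambda (- radial (Y x)) n2 Jfree l0 q0
  (radial_sqr (Y x)).
have -> : jacobian_mx Y x *m (jacobian_mx Y x)^T = metric c x by [].
move=> /(_ (fun k i j => christoffelE k i j Xiso ac cx)).
have normalE v : normal_part X c x v =
  v - v *m (jacobian_mx Y x)^T *m invmx (metric c x) *m jacobian_mx Y x.
  by rewrite /normal_part proj_kermxE// gJ.
move=> pos; have {pos} := pos _.
move: (soliton c x ac cx); rewrite /mean_curvature.
under eq_bigr => i _ do under eq_bigr => j _ do
  rewrite /second_fundamental_form normalE.
rewrite normalE => -> /(_ erefl).
rewrite /laplacian; congr (_ < _).
apply: eq_bigr => i _; apply: eq_bigr => j _; congr (_ * _).
rewrite -[_ \o chart_inv c]/(radial \o Y) p2 !rowK; congr (_ - _).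
by apply: eq_bigr => k _; rewrite rowK p1.
Qed.

Lemma radial_subharmonic (R : realType) (n N : nat)
    (M : riemannian_manifold R n) (lambda : R) (X : M -> 'rV[R]_N) :
  (2 < n)%N -> lambda <= 0 -> mcf_soliton lambda X ->
  subharmonic (radial \o X : M -> R^o).
Proof.
move=> n2 l0 hX; have [_ Xiso _] := hX.
have Y2 c : atlas c -> is_Ck 2 (chart_cod c) (X \o chart_inv c).
  by move=> ac; have := Xiso.1 2 c ac; rewrite preimage_setT setIT.
split=> [p|p U phi oU Up phi2 maxp c ac cp].
  have [c ac cp] := atlas_cover p.
  have oD := @chart_dom_open _ _ _ c; have oC := @chart_cod_open _ _ _ c.
  (* Near [p] the function factors through the chart, and its coordinate expression is continuous
     because it is differentiable. *)
  apply: (@near_eq_continuous _ _ ((radial \o (X \o chart_inv c)) \o c)).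
    apply: filterS (open_nbhs_nbhs (conj oD cp)) => q cq /=.
    by rewrite chart_funK.
  apply: continuous_comp; first exact: chart_fun_cts.
  apply: differentiable_continuous.
  exact: radial_differentiable oC (chart_funS cp) (Y2 c ac).
set x := c p; have cx : chart_cod c x by exact: chart_funS.
have oC := @chart_cod_open _ _ _ c.
(* The test function is known to be C^2 in coordinates only on this set, so the comparison takes
   place there. *)
pose V := chart_cod c `&` chart_inv c @^-1` U.
have oV : open V.
  rewrite openE => y [cy Uy]; apply: filterI.
    exact: open_nbhs_nbhs (conj oC cy).
  exact: chart_inv_cts cy _ (open_nbhs_nbhs (conj oU Uy)).
have Vx : V x by split => //; rewrite /= chart_funK.
have [v2 _ _] := partial_radial oC cx (Y2 c ac).
have w2 := is_Ck_twice_differentiable oV Vx (phi2 c ac).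
have [vw2 d1 d2] := twice_differentiableB v2 w2.
have vw_max : \forall y \near x,
    (radial \o (X \o chart_inv c) - (phi \o chart_inv c)) y <=
    (radial \o (X \o chart_inv c) - (phi \o chart_inv c)) x.
  apply: filterS (open_nbhs_nbhs (conj oV Vx)) => y [cy Uy].
  by rewrite !fctE /= /x chart_funK//; exact: maxp.
have [Jfree gJ] := Xiso.2 c x ac cx.
set J := jacobian_mx _ _ in Jfree gJ.
have GB : invmx (metric c x) =
    (invmx (metric c x) *m J) *m (invmx (metric c x) *m J)^T.
  rewrite trmx_mul mulmxA -(mulmxA _ J) -gJ mulVmx ?gram_unitmx// mul1mx.
  by rewrite trmx_inv trmx_mul trmxK.
have := elliptic_at_max (fun k i j => christoffel c k i j x) GB vw2 vw_max.
have := laplacian_radial_gt0 n2 l0 hX ac cx.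
(* Linearity of the Laplacian: the left side, nonpositive by [elliptic_at_max], is the Laplacian of
   the radial function minus that of [phi]. *)
suff -> : \sum_i \sum_j invmx (metric c x) i j *
    (partial i (partial j (radial \o (X \o chart_inv c) - (phi \o chart_inv c))) x
     - \sum_k christoffel c k i j x *
         partial k (radial \o (X \o chart_inv c) - (phi \o chart_inv c)) x) =
    laplacian c (radial \o X) x - laplacian c phi x.
  by rewrite subr_le0 => /ltW; exact: le_trans.
rewrite /laplacian -sumrB; apply: eq_bigr => i _.
rewrite -sumrB; apply: eq_bigr => j _; rewrite d2 -mulrBr; congr (_ * _).
under eq_bigr => k _ do rewrite d1 mulrBr.
have subrACA (a b s t : R) : a - b - (s - t) = a - s - (b - t) by ring.
by rewrite sumrB; exact: subrACA.
Qed.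

Theorem theorem3p1 (R : realType) (n m : nat) (hn : (2 < n)%N) (hm : (1 <= m)%N)
    (Sigma : riemannian_manifold R n) (X : Sigma -> 'rV[R]_(n + m)) (lambda : R)
    (hX : mcf_soliton lambda X) (hpar : parabolic Sigma) :
  self_shrinker lambda X.
Proof.
split=> //; rewrite ltNge; apply/negP => l0.
have [|a ua] := hpar _ (radial_subharmonic hn l0 hX).
  by exists 0 => p; exact/ltW/radial_lt0.
(* The contradiction is read at one point: the Laplacian of the constant function is 0 there, yet
   positive. *)
have [p _] := manifold_nonempty Sigma.
have [c ac cp] := atlas_cover p.
have := laplacian_radial_gt0 hn l0 hX ac (chart_funS cp).
rewrite (_ : radial \o X = cst a) ?ltxx//; last exact/funext.
have d0 k : partial k (cst a : 'rV[R]_n -> R^o) = cst 0.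
  by apply/funext => y; exact: derive_cst.
suff -> : laplacian c (cst a) (c p) = 0 by rewrite ltxx.
apply: big1 => i _; apply: big1 => j _.
rewrite (_ : cst a \o chart_inv c = cst a)// d0 [partial i _ _]derive_cst.
by rewrite big1 ?subrr ?mulr0// => k _; rewrite d0 mulr0.
Qed.
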